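(* Let $p$ be a prime number and let $K, K'$ be fields of characteristic $p$. Suppose that $K$ is algebraic over $\mathbb{F}_p$ and that the Golomb spaces $G(K[X])$ and $G(K'[X])$ are homeomorphic. Then $K$ and $K'$ are isomorphic as fields.
   Context: For an integral domain $R$ that is not a field, put $R^\bullet := R\setminus\{0\}$. The Golomb space $G(R)$ is the set $R^\bullet$ with the topology generated by the coprime cosets of $R$, i.e. by the sets $x+I$ (as subsets of $R^\bullet$, i.e. $(x+I)\cap R^\bullet$) where $x\in R^\bullet$, $I$ is a nonzero ideal of $R$, and $\langle x, I\rangle = R$. *)

(* Defs.v *)
From HB Require Import structures.
From mathcomp Require Import all_boot all_order all_algebra all_field.
From mathcomp Require Import boolp classical_sets topology.

Set Implicit Arguments.
Unset Strict Implicit.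
Unset Printing Implicit Defensive.

Import GRing.Theory.
Local Open Scope classical_set_scope.
Local Open Scope ring_scope.

(* Unlike [idealr_closed] of ring_quotient, which only describes proper ideals,
   this allows the unit ideal. *)
Definition is_ideal (R : comNzRingType) (I : set R) : Prop :=
  [/\ I 0, forall u v, I u -> I v -> I (u + v) & forall a u, I u -> I (a * u)].

Definition ideal_span (R : comNzRingType) (A : set R) : set R :=
  \bigcap_(J in [set J : set R | is_ideal J /\ A `<=` J]) J.

Record golomb (R : idomainType) : Type :=
  Golomb { golomb_val :> R; golomb_neq0 : golomb_val != 0 }.

HB.instance Definition _ (R : idomainType) := [isSub for @golomb_val R].
HB.instance Definition _ (R : idomainType) := [Choice of golomb R by <:].

(* The trace on R \ {0} of the coset x + I. *)
Definition golomb_coset (R : idomainType) (x : R) (I : set R) : set (golomb R) :=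
  [set y | exists2 i, I i & val y = x + i].

Definition coprime_cosets (R : idomainType) : set (set (golomb R)) :=
  [set U | exists (x : R) (I : set R),
    [/\ x != 0, is_ideal I, I != [set 0], ideal_span (x |` I) = [set: R]
      & U = golomb_coset x I]].

HB.instance Definition _ (R : idomainType) :=
  @isSubBaseTopological.Build (golomb R) (set (golomb R)) (@coprime_cosets R) id.

Definition homeomorphic (T U : topologicalType) : Prop :=
  exists (f : T -> U) (g : U -> T),
    [/\ cancel f g, cancel g f, continuous f & continuous g].

Definition field_isomorphic (K L : fieldType) : Prop :=
  exists f : {rmorphism K -> L}, bijective f.

(* [pPrimeCharType pK] is K endowed with its canonical 'F_p-algebra structure,
   so [in_alg] is the unique ring morphism 'F_p -> K. *)
Definition algebraic_over_Fp (p : nat) (K : fieldType) (pK : p \in [pchar K]) :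
    Prop :=
  forall x : K, algebraicOver (in_alg (pPrimeCharType pK)) x.

(* Main.v *)
(* A point of G(K[X]) has small neighbourhoods whose closures remember exactly the
   primes dividing it; so a homeomorphism h preserves coprimality, hence radicals,
   hence units and powers of a prime up to units.  Closures also show that h is
   continuous for the P-adic topology on the polynomials prime to P.

   For a prime f, let S be the set of all u f^n with u a unit and n >= 1.  If K is
   algebraic over F_p, then f is torsion modulo every Q prime to it, so no point of
   S is isolated for the join of the P-adic and Q-adic topologies.  Over K', take
   f = X, P = X - t and Q = X - 1: non-isolation forces t to be a root of unity, so
   K' is algebraic too.  Next, consider the y in S such that arbitrarily small
   Q-adic neighbourhoods of f and P-adic neighbourhoods of y meet in S.  When f = X,
   P = X - c and Q = X - 1 these are the c^i X, so there are ord(c) of them; in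
   general, if there are finitely many, they are the v f with v in a finite subgroup
   of the constants.  Hence K and K' have roots of unity of the same orders.
   Finally, morphisms from the finite subfields of K to K' are glued by an
   ultrafilter, and counting roots of unity makes the result surjective. *)
Require Import Defs.
From HB Require Import structures.
From mathcomp Require Import all_boot all_order all_algebra all_solvable all_field.
From mathcomp Require Import finmap.
From mathcomp Require Import boolp classical_sets filter topology.

Set Implicit Arguments.
Unset Strict Implicit.
Unset Printing Implicit Defensive.

Import GRing.Theory.
Local Open Scope classical_set_scope.
Local Open Scope ring_scope.

(** * Neighbourhoods in the Golomb space of K[X] *)

Section GolombPoly.
Variable K : fieldType.
Implicit Types (a b m x y z w : {poly K}) (u v : golomb {poly K}).

Lemma principal_ideal (I : set {poly K}) : is_ideal I -> I != [set 0] ->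
  exists2 m, m != 0 & I = [set x | m %| x].
Proof.
move=> [I0 ID IM] In0.
have [m0 Im0 m0n0] : exists2 m, I m & m != 0.
  apply: contrapT => noI; move/eqP: In0; apply; apply/seteqP; split=> x /=.
    by move=> Ix; apply: contrapT => /eqP xn0; apply: noI; exists x.
  by move->.
have exI : exists n, `[< exists2 m, I m /\ m != 0 & size m = n >].
  by exists (size m0); apply/asboolP; exists m0.
have [n /asboolP[m [Im mn0] <-] minm] := ex_minnP exI.
exists m => //; apply/seteqP; split=> x /=; last by move=> /dvdpP[q ->]; exact: IM.
move=> Ix; rewrite /dvdp -[_ == 0]negbK; apply/negP => rn0.
suff /minm : `[< exists2 m', I m' /\ m' != 0 & size m' = size (x %% m) >].
  by rewrite leqNgt ltn_modp mn0.
apply/asboolP; exists (x %% m) => //; split=> //.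
have -> : x %% m = x + (- (x %/ m)) * m.
  by rewrite {2}(divp_eq x m) mulNr addrAC subrr add0r.
by apply: ID => //; exact: IM.
Qed.

Lemma is_ideal_dvdp m : is_ideal [set x | m %| x].
Proof.
split=> /= [|x y|a x]; [exact: dvdp0|exact: dvdp_add|exact: dvdp_mull].
Qed.

Lemma ideal_span_coprimep m x : ideal_span (x |` [set y | m %| y]) = setT <->
  coprimep m x.
Proof.
split=> [spanT|mx].
  have /(_ [set y | gcdp m x %| y]) : ideal_span (x |` [set y | m %| y]) 1.
    by rewrite spanT.
  rewrite -gcdp_eqp1 /eqp dvd1p andbT; apply; split; first exact: is_ideal_dvdp.
  by move=> y /= [->|]; [exact: dvdp_gcdr|apply: dvdp_trans; exact: dvdp_gcdl].
apply/seteqP; split=> // y _ J [[J0 JD JM] sJ].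
have /Bezout_eq1_coprimepP[[a b] /= ab1] := mx.
rewrite -[y]mulr1 -ab1; apply: (JM); apply: JD; apply: JM; apply: sJ;
  [right|left] => //=.
Qed.

Lemma golomb_openP (R : idomainType) (A : set (golomb R)) :
  open A <-> exists2 D, D `<=` finI_from (@coprime_cosets R) id &
    \bigcup_(U in D) U = A.
Proof. by []. Qed.

Lemma open_coset u m : m != 0 -> coprimep m (golomb_val u) ->
  open [set v : golomb {poly K} | m %| golomb_val v - golomb_val u].
Proof.
move=> m0 mu; apply/golomb_openP.
exists [set [set v : golomb {poly K} | m %| golomb_val v - golomb_val u]];
  last by rewrite bigcup_set1.
move=> _ /= ->; apply: (@finI_from1 _ _ (@coprime_cosets {poly K}) id).
exists (golomb_val u), [set y | m %| y]; split.
- exact: golomb_neq0.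
- exact: is_ideal_dvdp.
- apply/eqP => /seteqP[/(_ m) /=]; rewrite dvdpp => /(_ isT) mE; move: m0;
  by rewrite mE eqxx.
- exact: (iffRL (ideal_span_coprimep m _) mu).
- apply/seteqP; split=> v /=; first by move=> ?;
  exists (golomb_val v - golomb_val u); rewrite // addrC subrK.
  by move=> [i mi ->]; rewrite addrC addKr.
Qed.

(** Subbasic cosets through [u] can be recentred at [u], and the intersection of finitely many
    contains the class of [u] modulo the product of their moduli, still coprime to [u]. *)
Lemma nbhs_golombP u (B : set (golomb {poly K})) :
  nbhs u B <-> exists2 m, m != 0 /\ coprimep m (golomb_val u)
    & forall v, m %| golomb_val v - golomb_val u -> B v.
Proof.
split=> [|[m [m0 mu] sB]]; last first.
  rewrite nbhsE; exists [set v | m %| golomb_val v - golomb_val u] => //.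
  by split; [exact: open_coset|rewrite /= subrr dvdp0].
rewrite nbhsE => -[A [/golomb_openP[D sD <-] [U DU Uu]] sAB].
suff [m [m0 mu] sU] : exists2 m, m != 0 /\ coprimep m (golomb_val u)
    & forall v, m %| golomb_val v - golomb_val u -> U v.
  by exists m => // v /sU Uv; apply: sAB; exists U.
have [F sF UE] := sD _ DU; move: Uu; rewrite -{}UE => Fu.
have {sF} {}Fu : forall V, V \in (F : seq _) -> coprime_cosets V /\ V u.
  by move=> V VF; split; [exact: set_mem (sF _ VF)|exact: Fu].
suff H (s : seq (set (golomb {poly K}))) : (forall V, V \in s ->
  coprime_cosets V /\ V u) ->
    exists2 m, m != 0 /\ coprimep m (golomb_val u)
    & forall v, m %| golomb_val v - golomb_val u -> forall V, V \in s -> V v.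
  by have [m ? sB] := H _ Fu; exists m => // v /sB vF V; exact: vF.
elim: s => [_|V s IH Vs].
  by exists 1 => //; rewrite oner_eq0 coprime1p.
have [|m [m0 mu] ms] := IH; first by move=> W Ws; apply: Vs; rewrite in_cons Ws orbT.
have [|[x [I [x0 idI In0 xI VE]]] Vu] := Vs V; first by rewrite mem_head.
have [m' m'0 IE] := principal_ideal idI In0; rewrite {}IE {In0 idI} in VE xI.
have {xI} m'x := iffLR (ideal_span_coprimep m' x) xI.
have m'ux : m' %| golomb_val u - x by move: Vu; rewrite VE => -[i /= ? ->];
  rewrite addrC addKr.
exists (m * m').
  rewrite mulf_neq0 // coprimepMl mu -coprimep_modr.
  have -> : golomb_val u = golomb_val u - x + x by rewrite subrK.
  by rewrite modpD (modp_eq0 m'ux) add0r coprimep_modr.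
move=> v mm'v W; rewrite in_cons => /predU1P[->|].
  rewrite VE; exists (golomb_val v - x); last by rewrite addrC subrK.
  by rewrite /= -(subrK (golomb_val u) (golomb_val v)) -addrA dvdp_add // (dvdp_trans
    _ mm'v) // dvdp_mull.
by apply: ms; rewrite (dvdp_trans _ mm'v) // dvdp_mulr.
Qed.
End GolombPoly.

(** * Prime factors and congruences in [K[X]] *)

Section PolyArith.
Variable K : fieldType.
Implicit Types (f m l q w x y : {poly K}).

Lemma exists_irreducible q : (1 < size q)%N ->
  exists2 f, irreducible_poly f & f %| q.
Proof.
have [n] := ubnP (size q); elim: n q => // n IH q qn q1.
have [irr|] := pselect (irreducible_poly q); first by exists q.
move=> /not_andP[//|/existsNP[d /not_implyP[d1 /not_implyP[dq /negP ndq]]]].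
have q0 : q != 0 by rewrite -size_poly_gt0 ltnW.
have d0 : d != 0 by apply: contraNneq q0 => d0; rewrite -dvd0p -d0.
have ltdq : (size d < size q)%N.
  rewrite ltn_neqAle dvdp_leq // andbT.
  by apply: contra ndq => /eqP E; rewrite -dvdp_size_eqp // E.
have [||f irr fd] := IH d; first exact: leq_trans ltdq _.
  by rewrite ltn_neqAle eq_sym d1 size_poly_gt0.
by exists f => //; exact: dvdp_trans dq.
Qed.

Lemma irreducible_coprimep f q : irreducible_poly f -> ~~ (f %| q) -> coprimep f q.
Proof.
move=> [f1 irr] fq; apply: contraNT fq; rewrite coprimep_def => g1.
by rewrite -(eqp_dvdl _ (irr _ g1 (dvdp_gcdl _ _))) dvdp_gcdr.
Qed.

Lemma coprimep_irreducibleP m q : m != 0 ->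
  (forall f, irreducible_poly f -> f %| m -> ~~ (f %| q)) -> coprimep m q.
Proof.
move=> m0 H; apply: contrapT => /negP; rewrite coprimep_def => g1.
have [|f irr fg] := @exists_irreducible (gcdp m q).
  by rewrite ltn_neqAle eq_sym g1 size_poly_gt0 gcdp_eq0 negb_and m0.
by move: (H f irr); rewrite !(dvdp_trans fg) ?dvdp_gcdl ?dvdp_gcdr //= => /(_ isT).
Qed.

(** Repeatedly splitting off [gcdp m q] collects in [a] the primes of [m] that divide [q]. *)
Lemma split_coprimep m q : m != 0 ->
  exists a b e, [/\ m = a * b, a %| q ^+ e & coprimep b q].
Proof.
have [n] := ubnP (size m); elim: n m => // n IH m mn m0.
have [mq|] := boolP (coprimep m q).
  by exists 1, m, 0%N; rewrite mul1r dvd1p.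
rewrite coprimep_def => g1.
have /dvdpP[m' mE] := dvdp_gcdl m q; set g := gcdp m q in g1 mE.
have : m' * g != 0 by rewrite -mE.
rewrite mulf_eq0 negb_or => /andP[m'0 g0].
have [|a [b [e [m'E aq bq]]]] := IH m' _ m'0.
  apply: (@leq_trans (size m)); last by rewrite -ltnS.
  have -> : size m = size (m' * g) by rewrite -mE.
  rewrite size_mul //.
  move: g1 g0; rewrite -size_poly_eq0; case: (size g) => [|[|k]] // _ _.
  by rewrite !addnS /= ltnS leq_addr.
exists (g * a), b, e.+1; split=> //; first by rewrite mE m'E mulrC mulrA.
by rewrite exprS dvdp_mul // dvdp_gcdr.
Qed.

Lemma eqmodp_coprimep m x y : m %| x - y -> coprimep m x = coprimep m y.
Proof.
by move=> mxy; rewrite -[x](subrK y) addrC -coprimep_modr modpD (modp_eq0 mxy) addr0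
  coprimep_modr.
Qed.

Lemma chinese_poly m l x y : gcdp m l %| x - y ->
  exists w, m %| w - x /\ l %| w - y.
Proof.
have [[a b] /= /eqp_dvdl <-] := Bezoutp m l.
move=> /dvdpP[q xyE]; exists (x - q * a * m); split.
  by rewrite addrAC subrr add0r dvdpNr dvdp_mull.
by rewrite addrAC xyE mulrDr mulrA addrAC subrr add0r mulrA dvdp_mull.
Qed.
End PolyArith.

(** * Closures of congruence classes *)

Section GolombClosure.
Variable K : fieldType.
Implicit Types (a b l m : {poly K}) (u v w : golomb {poly K}).

Definition congr_class u m : set (golomb {poly K}) :=
  [set v | m %| golomb_val v - golomb_val u].

Lemma nbhs_coset u m : m != 0 -> coprimep m (golomb_val u) -> nbhs u (congr_class u m).
Proof. by move=> m0 mu; apply/nbhs_golombP; exists m. Qed.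

Lemma golomb_chinese m l (x y : {poly K}) : m != 0 -> l != 0 -> gcdp m l %| x - y ->
  exists v : golomb {poly K}, m %| golomb_val v - x /\ l %| golomb_val v - y.
Proof.
move=> m0 l0 /chinese_poly[w [mw lw]].
(* Points of the Golomb space are nonzero, so the solution 0 is shifted by [m * l]. *)
have [w0|w0] := eqVneq w 0; last by exists (Golomb w0).
have ml0 : w + m * l != 0 by rewrite w0 add0r mulf_neq0.
exists (Golomb ml0) => /=; split.
  by rewrite addrAC dvdp_add // dvdp_mulr.
by rewrite addrAC dvdp_add // dvdp_mull.
Qed.

(** The last hypothesis says that every prime of [b] divides [w]. The modulus of a neighbourhood of
    [w] is coprime to [w], hence to [b], so only the condition modulo [a] could prevent a common
    point. *)
Lemma closure_coset u w a b : a * b != 0 -> a %| golomb_val w - golomb_val u ->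
  (forall l, l != 0 -> coprimep l (golomb_val w) -> coprimep l b) ->
  closure (congr_class u (a * b)) w.
Proof.
move=> ab0 aw H C /nbhs_golombP[l [l0 lw] lC].
have [|v [abv lv]] := @golomb_chinese (a * b) l (golomb_val u) (golomb_val w) ab0 l0.
  rewrite (@dvdp_trans _ a) // -1?opprB ?dvdpNr // .
  rewrite -(@Gauss_dvdpl _ a b) ?dvdp_gcdl //.
  by apply: (@coprimep_dvdr _ l) (H _ l0 lw); exact: dvdp_gcdr.
by exists v; split => //; exact: lC.
Qed.

Lemma closure_coset_dvdp u w m l : l != 0 -> l %| m -> coprimep l (golomb_val w) ->
  closure (congr_class u m) w -> l %| golomb_val w - golomb_val u.
Proof.
move=> l0 lm lw /(_ _ (nbhs_coset l0 lw))[v [/= mv lv]].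
have -> : golomb_val w - golomb_val u = golomb_val v - golomb_val u - (golomb_val v -
  golomb_val w).
  by rewrite opprB [RHS]addrC addrA subrK.
by rewrite dvdp_sub // (dvdp_trans lm).
Qed.
End GolombClosure.

(** * Coprimality is topological *)

Lemma closure_preimage (T S : topologicalType) (f : T ->
  S) (A : set S) : continuous f ->
  closure (f @^-1` A) `<=` f @^-1` closure A.
Proof. by move=> cf x clx B /cf /clx[y [Ay By]]; exists (f y). Qed.

(* A point [w] lies in the closure of [x + (m)] iff every prime power [q ^ e]
   exactly dividing [m] satisfies [q %| w] or [q ^ e %| w - x].  Hence a prime
   dividing at most one of [x, y, z] is forced to divide the common points of the
   closures of small neighbourhoods of [x, y, z], whereas a prime dividing two of
   them is not: separation characterizes pairwise coprimality. *)
Definition separated_triple (T : topologicalType) (x y z : T) : Prop :=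
  forall U : set T, open U -> U !=set0 -> exists A B C,
    [/\ nbhs x A, nbhs y B, nbhs z C & closure A `&` closure B `&` closure C `<=`
      closure U].

Lemma separated_triple_homeo (T S : topologicalType) (f : T -> S) (g : S -> T) :
  cancel f g -> cancel g f -> continuous f -> continuous g ->
  forall x y z, separated_triple x y z -> separated_triple (f x) (f y) (f z).
Proof.
move=> fK gK cf cg x y z H U oU [u Uu].
have [||A [B [C [xA yB zC sU]]]] := H (f @^-1` U).
- by apply: open_comp => // t _; exact: cf.
- by exists (g u); rewrite /= gK.
have pre t D : nbhs t D -> nbhs (f t) (g @^-1` D) by move=> tD; apply: cg; rewrite fK.
exists (g @^-1` A), (g @^-1` B), (g @^-1` C); split; try exact: pre.
move=> w [[wA wB] wC].
have /closure_preimage : closure (f @^-1` U) (g w).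
  by apply: sU; split; [split|]; [exact: closure_preimage cg _ wA|exact:
    closure_preimage cg _ wB|exact: closure_preimage cg _ wC].
by rewrite /= gK; exact.
Qed.

Section GolombSeparatedTriple.
Variable K : fieldType.
Implicit Types (f m l : {poly K}) (u v w x y z : golomb {poly K}).

(** [B] is the class of [x] modulo the [N]-th power of the part of [m] coprime to [x], which
    contains every prime of [m] not dividing [x]. *)
Lemma nbhs_closure_exp x m N : m != 0 -> exists2 B, nbhs x B &
  forall w f, irreducible_poly f -> f %| m -> ~~ (f %| golomb_val x) ->
    ~~ (f %| golomb_val w) -> closure B w -> f ^+ N %| golomb_val w - golomb_val x.
Proof.
move=> m0; have [a [b [e [mE ax bx]]]] := split_coprimep (golomb_val x) m0.
have b0 : b != 0 by apply: contra_neq m0 => b0; rewrite mE b0 mulr0.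
exists (congr_class x (b ^+ N)).
  by apply: nbhs_coset; rewrite ?expf_neq0 ?coprimep_expl.
move=> w f irr fm fx fw; apply: closure_coset_dvdp.
- by rewrite expf_neq0 // irredp_neq0.
- apply: dvdp_exp2r; move: fm; rewrite mE Gauss_dvdpr //.
  by apply: coprimep_dvdl ax _; apply: coprimep_expr; exact: irreducible_coprimep.
- by apply: coprimep_expl; exact: irreducible_coprimep.
Qed.

Lemma exp_irreducible_dvdp f (N : nat) (p : {poly K}) : irreducible_poly f -> p != 0 ->
  (size p <= N)%N -> ~~ (f ^+ N %| p).
Proof.
move=> irr p0 pN; apply/negP => /(dvdp_leq p0) sfp.
have := leq_trans sfp pN; rewrite leqNgt; have [f1 _] := irr.
rewrite -[size _]prednK ?size_exp ?size_poly_gt0 ?expf_neq0 ?irredp_neq0 //.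
by rewrite ltnS -[X in (X <= _)%N]mul1n leq_mul2r -ltnS prednK ?(ltnW f1) // f1 orbT.
Qed.

Lemma golomb_val_inj : injective (@golomb_val {poly K}).
Proof. exact: val_inj. Qed.

(** A prime [f] of the modulus [m] of [U] divides at most one of the three points. If [f] did not
    divide [w], then [w] would be congruent modulo [f ^+ N] to two others, whose nonzero difference
    has too small a degree. So every prime of [m] divides [w], which puts [w] in the closure of
    [U]. *)
Lemma coprimep_separated_triple x y z :
  x <> y -> y <> z -> x <> z ->
  coprimep (golomb_val x) (golomb_val y) -> coprimep (golomb_val y) (golomb_val z) ->
  coprimep (golomb_val x) (golomb_val z) -> separated_triple x y z.
Proof.
move=> xNy yNz xNz xy yz xz U oU [u Uu].
have /nbhs_golombP[m [m0 mu] sU] : nbhs u U by apply: open_nbhs_nbhs.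
pose d v w := size (golomb_val v - golomb_val w).
pose N := (d x y + d y z + d x z)%N.
have [A xA HA] := nbhs_closure_exp x N m0.
have [B yB HB] := nbhs_closure_exp y N m0.
have [C zC HC] := nbhs_closure_exp z N m0.
exists A, B, C; split => // w [[wA wB] wC].
apply: (@closure_subset _ (congr_class u (1 * m))); first by move=> v;
  rewrite /congr_class /= mul1r; exact: sU.
apply: closure_coset; rewrite ?mul1r ?dvd1p // => l l0 lw.
rewrite coprimep_sym; apply: coprimep_irreducibleP => // f irr fm; apply/negP => fl.
have fw : ~~ (f %| golomb_val w).
  have [f1 _] := irr; apply: contraL lw => fw; rewrite coprimep_def gtn_eqF //.
  by rewrite (leq_trans f1) // dvdp_leq ?dvdp_gcd ?fl // gcdp_eq0 negb_and l0.
have contra v v' : v <> v' -> (d v v' <= N)%N -> f ^+ N %| golomb_val w - golomb_val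
  v ->
    f ^+ N %| golomb_val w - golomb_val v' -> False.
  move=> vv' dN wv wv'.
  have v0 : golomb_val v - golomb_val v' != 0.
    by rewrite subr_eq0; apply/eqP => /golomb_val_inj.
  apply: (negP (exp_irreducible_dvdp irr v0 dN)).
  have -> : golomb_val v - golomb_val v' =
    golomb_val w - golomb_val v' - (golomb_val w - golomb_val v).
    by rewrite opprB [RHS]addrC addrA subrK.
  exact: dvdp_sub.
have two v v' : coprimep (golomb_val v) (golomb_val v') ->
    ~~ (f %| golomb_val v) || ~~ (f %| golomb_val v').
  move=> vv'; rewrite -negb_and; apply/negP => /andP[fv fv'].
  have := coprimep_dvdl fv' (coprimep_dvdr fv vv'); rewrite coprimepp.
  by have [f1 _] := irr; rewrite gtn_eqF.
have xyN : (d x y <= N)%N by rewrite /N -addnA leq_addr.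
have yzN : (d y z <= N)%N by rewrite /N addnAC leq_addl.
have xzN : (d x z <= N)%N by rewrite /N leq_addl.
have [fx|fx] := boolP (f %| golomb_val x).
  move: (two _ _ xy) (two _ _ xz); rewrite fx /= => fy fz.
  exact: (contra _ _ yNz yzN (HB _ _ irr fm fy fw wB) (HC _ _ irr fm fz fw wC)).
have [fy|fy] := boolP (f %| golomb_val y).
  move: (two _ _ yz); rewrite fy /= => fz.
  exact: (contra _ _ xNz xzN (HA _ _ irr fm fx fw wA) (HC _ _ irr fm fz fw wC)).
exact: (contra _ _ xNy xyN (HA _ _ irr fm fx fw wA) (HB _ _ irr fm fy fw wB)).
Qed.

(** If a prime [f] divides [x] and [y], their neighbourhoods impose nothing modulo [f]; only [z] may
    restrict residues there. Some [w] in all three closures then avoids, modulo [f ^+ 2], a suitable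
    class. *)
Lemma separated_triple_coprimep x y z : separated_triple x y z ->
  coprimep (golomb_val x) (golomb_val y).
Proof.
move=> sep; apply: coprimep_irreducibleP; first exact: golomb_neq0.
move=> f irr fx; apply/negP => fy.
have f0 := irredp_neq0 irr; have [f1 _] := irr.
have fN1 : ~~ (f %| 1) by rewrite dvdp1 gtn_eqF.
(* [b] is the residue wanted for [w] at [f]: that of [z], or 1 when [f] divides [z] and [z] imposes
   none. The class to be avoided is that of [b + f]. *)
pose b : {poly K} := if f %| golomb_val z then 1 else golomb_val z.
have fb : ~~ (f %| b) by rewrite /b; case: ifP => // ->.
have fa : ~~ (f %| b + f) by rewrite dvdp_addl.
have a0 : b + f != 0 by apply: contraNneq fa => ->; exact: dvdp0.
pose a := Golomb a0.
have f2a : coprimep (f ^+ 2) (golomb_val a).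
  by apply: coprimep_expl; exact: irreducible_coprimep.
have := sep (congr_class a (f ^+ 2)) (open_coset (expf_neq0 _ f0) f2a).
case; first by exists a; rewrite /congr_class /= subrr dvdp0.
move=> A [B [C [/nbhs_golombP[i [i0 ix] iA] /nbhs_golombP[j [j0 jy] jB]
  /nbhs_golombP[l [l0 lz] lC] sU]]].
have [c [d [e [lE cf df]]]] := split_coprimep f l0.
have fi : coprimep (f ^+ e.+2) i.
  by rewrite coprimep_sym; apply: coprimep_expr; apply: coprimep_dvdl ix.
have fj : coprimep (f ^+ e.+2) j.
  by rewrite coprimep_sym; apply: coprimep_expr; apply: coprimep_dvdl jy.
have fd : coprimep (f ^+ e.+2) d by rewrite coprimep_sym coprimep_expr.
have cd0 : c * d != 0 by rewrite -lE.
(* The exponent [e.+2] covers both [c], which divides [f ^+ e], and [f ^+ 2]; divisibility of [w] by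
   [i], [j] and [d] makes these moduli harmless in closures. *)
have [|||w [fw]] := @golomb_chinese K (f ^+ e.+2) (i * j * d) b 0.
- exact: expf_neq0.
- by rewrite !mulf_neq0 //; apply: contra_neq cd0 => ->; rewrite mulr0.
- have : coprimep (f ^+ e.+2) (i * j * d) by rewrite !coprimepMr fi fj fd.
  by rewrite -gcdp_eqp1 => /eqp_dvdl ->; exact: dvd1p.
rewrite subr0 => ijdw.
have iw : i %| golomb_val w by apply: dvdp_trans ijdw; rewrite -mulrA dvdp_mulr.
have jw : j %| golomb_val w by apply: dvdp_trans ijdw; rewrite dvdp_mulr // dvdp_mull.
have dw : d %| golomb_val w by apply: dvdp_trans ijdw; rewrite dvdp_mull.
have clI (t : golomb {poly K}) (k : {poly K}) (D : set (golomb {poly K})) : k != 0 ->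
  k %| golomb_val w ->
    (forall v, k %| golomb_val v - golomb_val t -> D v) -> closure D w.
  move=> k0 kw kD; apply: (@closure_subset _ (congr_class t (1 * k))).
    by move=> v; rewrite /congr_class /= mul1r; exact: kD.
  apply: closure_coset; rewrite ?mul1r ?dvd1p // => q q0; exact: coprimep_dvdl.
have cw : c %| golomb_val w - golomb_val z.
  have [fz|fz] := boolP (f %| golomb_val z); last first.
    move: fw; rewrite /b (negbTE fz); apply: dvdp_trans; apply: dvdp_trans cf _.
    by apply: dvdp_exp2l; rewrite -addn2 leq_addr.
  have cz : c %| golomb_val z ^+ e by apply: dvdp_trans cf _; exact: dvdp_exp2r.
  have := coprimep_dvdr _ (coprimep_expr e lz); move/(_ c);
    rewrite lE dvdp_mulr // => /(_ isT).
  move/(coprimep_dvdl cz); rewrite coprimepp size_poly_eq1 => /eqp_dvdl ->.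
  exact: dvd1p.
have : closure (congr_class a (f ^+ 2)) w.
  apply: sU; split; first split; [exact: clI iA|exact: clI jB|].
  apply: (@closure_subset _ (congr_class z (c * d))).
    by move=> v; rewrite /congr_class /= -lE; exact: lC.
  by apply: closure_coset => // q _; exact: coprimep_dvdl.
have f2 : f ^+ 2 %| f ^+ e.+2 by apply: dvdp_exp2l.
have f2w := dvdp_trans f2 fw.
have wa : coprimep (f ^+ 2) (golomb_val w).
  rewrite (eqmodp_coprimep f2w); apply: coprimep_expl; exact: irreducible_coprimep.
move/(closure_coset_dvdp (expf_neq0 2 f0) (dvdpp _) wa) => /= f2w'.
have : f ^+ 2 %| f.
  have fE : f = golomb_val w - b - (golomb_val w - (b + f)).
    by rewrite opprB [RHS]addrC addrA subrK addrC addKr.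
  by rewrite [X in _ %| X]fE dvdp_sub.
move=> /(dvdp_leq f0); rewrite leqNgt -[size (f ^+ 2)]prednK ?size_poly_gt0
  ?expf_neq0 //.
rewrite size_exp ltnS -{1}[size f]prednK ?(ltnW f1) // muln2 -addnn -{1}add1n leq_add2r.
by rewrite -ltnS prednK ?(ltnW f1) // f1.
Qed.

End GolombSeparatedTriple.

Definition inverse_homeos (T S : topologicalType) (h : T -> S) (g : S -> T) : Prop :=
  [/\ cancel h g, cancel g h, continuous h & continuous g].

Lemma inverse_homeosC (T S : topologicalType) (h : T -> S) (g : S -> T) :
  inverse_homeos h g -> inverse_homeos g h.
Proof. by case. Qed.

Section GolombCoprime.
Variable K : fieldType.
Implicit Types (x y z : golomb {poly K}).

(** The third point [x * y * 'X + 1] is coprime to both, and its factor ['X] makes its degree exceed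
    theirs, even for constants. *)
Lemma coprimep_separated_tripleP x y : x <> y ->
  coprimep (golomb_val x) (golomb_val y) <->
  exists z, [/\ x <> z, y <> z & separated_triple x y z].
Proof.
move=> xy; split=> [cxy|[z [_ _]]]; last exact: separated_triple_coprimep.
have x0 := golomb_neq0 x; have y0 := golomb_neq0 y.
pose q : {poly K} := golomb_val x * golomb_val y * 'X.
have q0 : q != 0 by rewrite !mulf_neq0 // polyX_eq0.
have sq : size q = (size (golomb_val x) + size (golomb_val y))%N.
  rewrite size_mulX ?mulf_neq0 // size_mul // prednK // addn_gt0 !size_poly_gt0.
  by rewrite x0.
have sz : size (q + 1) = size q.
  rewrite size_polyDl // size_poly1 sq.
  by apply: (@leq_add 1 1); rewrite size_poly_gt0.
have z0 : q + 1 != 0 by rewrite -size_poly_gt0 sz size_poly_gt0.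
have cz (t : {poly K}) : t %| q -> coprimep t (q + 1).
  by move=> tq; rewrite -coprimep_modr modpD (modp_eq0 tq) add0r coprimep_modr
    coprimep1.
have zx : x <> Golomb z0.
  move=> /(congr1 (fun t : golomb {poly K} => size (golomb_val t : {poly K})))/= /eqP.
  by rewrite sz sq -{1}[size (golomb_val x)]addn0 eqn_add2l eq_sym size_poly_eq0
    (negbTE y0).
have zy : y <> Golomb z0.
  move=> /(congr1 (fun t : golomb {poly K} => size (golomb_val t : {poly K})))/= /eqP.
  by rewrite sz sq -{1}[size (golomb_val y)]add0n eqn_add2r eq_sym size_poly_eq0
    (negbTE x0).
exists (Golomb z0); split => //; apply: coprimep_separated_triple => //=; apply: cz.
  by rewrite /q mulrAC dvdp_mull.
by rewrite /q -mulrA dvdp_mulr.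
Qed.

(** Being coprime to itself means being a unit. The criterion by triples covers only distinct
    points, so units are recognized by their coprimality to all other points; ['X] times [x] is the
    test point. *)
Lemma unit_coprimepP x : coprimep (golomb_val x) (golomb_val x) <->
  forall y, x <> y -> coprimep (golomb_val x) (golomb_val y).
Proof.
split=> [|H].
  rewrite coprimepp size_poly_eq1 => x1 y _.
  by rewrite coprimep_sym (eqp_coprimepr _ x1) coprimep1.
have x0 := golomb_neq0 x.
have y0 : golomb_val x * 'X != 0 by rewrite mulf_neq0 // polyX_eq0.
have : coprimep (golomb_val x) (golomb_val (Golomb y0)).
  apply: H => /(congr1 (fun t : golomb {poly K} =>
    size (golomb_val t : {poly K})))/= /eqP.
  by rewrite size_mulX // ltn_eqF.
by rewrite /= coprimepMr => /andP[].
Qed.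

End GolombCoprime.

Lemma homeo_coprimep_imp (K K' : fieldType)
    (h : golomb {poly K} -> golomb {poly K'}) g x y :
  inverse_homeos h g -> x <> y -> coprimep (golomb_val x) (golomb_val y) ->
  coprimep (golomb_val (h x)) (golomb_val (h y)).
Proof.
move=> [hK gK ch cg] xy /coprimep_separated_tripleP => /(_ xy)[z [xz yz sxyz]].
have inj := can_inj hK.
apply/coprimep_separated_tripleP; first by move/inj.
exists (h z); split; [by move/inj|by move/inj|].
exact: separated_triple_homeo sxyz.
Qed.

Lemma homeo_unit (K K' : fieldType) (h : golomb {poly K} -> golomb {poly K'}) g x :
  inverse_homeos h g -> coprimep (golomb_val x) (golomb_val x) ->
  coprimep (golomb_val (h x)) (golomb_val (h x)).
Proof.
move=> hg /unit_coprimepP ux; apply/unit_coprimepP => y.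
have [hK gK _ _] := hg; rewrite -[y]gK => xy.
by apply: homeo_coprimep_imp hg _ _ => [E|]; [apply: xy; rewrite E|apply: ux => E;
  apply: xy; rewrite E].
Qed.

Lemma homeo_coprimep (K K' : fieldType) (h : golomb {poly K} ->
  golomb {poly K'}) g x y :
  inverse_homeos h g ->
  coprimep (golomb_val (h x)) (golomb_val (h y)) = coprimep (golomb_val x)
    (golomb_val y).
Proof.
move=> hg; have gh := inverse_homeosC hg; have [hK gK _ _] := hg.
have [->|xy] := pselect (x = y).
  by apply/idP/idP; [rewrite -{3 4}[y]hK; exact: homeo_unit gh|exact: homeo_unit hg].
apply/idP/idP; last exact: homeo_coprimep_imp hg xy.
rewrite -{2}[x]hK -{2}[y]hK; apply: homeo_coprimep_imp gh _.
by move/(can_inj hK).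
Qed.

(* Golomb neighbourhoods also constrain residues modulo primes other than those
   of [P].  Those constraints disappear in closures: a point that is [P]-adically
   close to [z] and divisible by the part of both moduli prime to [P] lies in the
   closures of neighbourhoods of both [x] and [z]. *)
Lemma homeo_adic_continuous (K K' : fieldType)
    (h : golomb {poly K} -> golomb {poly K'}) g x P (n : nat) :
  inverse_homeos h g -> coprimep (golomb_val x) (golomb_val P) ->
  exists e : nat, forall z, golomb_val P ^+ e %| golomb_val z - golomb_val x ->
    golomb_val (h P) ^+ n %| golomb_val (h z) - golomb_val (h x).
Proof.
move=> hg xP; have [hK gK ch cg] := hg.
set Q := golomb_val (h P); set p := golomb_val P in xP *.
have p0 : p != 0 := golomb_neq0 P.
have Q0 : Q ^+ n != 0 by rewrite expf_neq0 // golomb_neq0.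
have cosetQ t : coprimep (golomb_val t) p ->
    nbhs t (h @^-1` congr_class (h t) (Q ^+ n)).
  move=> tP; apply: ch; apply: nbhs_coset => //.
  by rewrite coprimep_sym coprimep_expr // (homeo_coprimep _ _ hg).
have /nbhs_golombP[m [m0 mx] sm] := cosetQ x xP.
have [a [b [e [mE ap bp]]]] := split_coprimep p m0.
(* The extra 1 makes [z] congruent to [x] modulo [p] even when [e] is 0, so that [z] is coprime to
   [p]. *)
exists e.+1 => z pzx.
have pe k : p %| p ^+ k.+1 by rewrite exprS dvdp_mulr.
have zP : coprimep (golomb_val z) p.
  rewrite coprimep_sym (@eqmodp_coprimep _ p _ (golomb_val x)) 1?coprimep_sym //.
  exact: dvdp_trans pzx.
have /nbhs_golombP[l [l0 lz] sl] := cosetQ z zP.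
have [c [d [k [lE cp dp]]]] := split_coprimep p l0.
have b0 : b != 0 by apply: contra_neq m0 => b0; rewrite mE b0 mulr0.
have d0 : d != 0 by apply: contra_neq l0 => d0; rewrite lE d0 mulr0.
have [|||w [pw bdw]] := @golomb_chinese K (p ^+ (e + k).+1) (b * d) (golomb_val z) 0.
- exact: expf_neq0.
- exact: mulf_neq0.
- have : coprimep (p ^+ (e + k).+1) (b * d) by rewrite coprimep_expl // coprimepMr
  ![coprimep p _]coprimep_sym bp dp.
  by rewrite -gcdp_eqp1 => /eqp_dvdl ->; exact: dvd1p.
rewrite subr0 in bdw.
have wP : coprimep (golomb_val w) p.
  rewrite coprimep_sym (@eqmodp_coprimep _ p _ (golomb_val z)) 1?coprimep_sym //.
  exact: dvdp_trans pw.
have wx : a %| golomb_val w - golomb_val x.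
  apply: dvdp_trans ap _; rewrite -(subrK (golomb_val z) (golomb_val w)) -addrA
    dvdp_add //.
    by apply: dvdp_trans pw; apply: dvdp_exp2l; rewrite -addnS leq_addr.
  by apply: dvdp_trans pzx; apply: dvdp_exp2l.
have wz : c %| golomb_val w - golomb_val z.
  apply: dvdp_trans cp _; apply: dvdp_trans pw; apply: dvdp_exp2l.
  by rewrite -addSn leq_addl.
have clw t r s : r * s != 0 -> r %| golomb_val w - golomb_val t -> s %| golomb_val w ->
    (forall v, r * s %| golomb_val v - golomb_val t ->
      (h @^-1` congr_class (h t) (Q ^+ n)) v) ->
    Q ^+ n %| golomb_val (h w) - golomb_val (h t).
  move=> rs0 rw sw srs; apply: (@closure_coset_dvdp _ _ _ (Q ^+ n)) => //.
    by rewrite coprimep_sym coprimep_expr // (homeo_coprimep _ _ hg).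
  apply: (closure_preimage ch); apply: (@closure_subset _ (congr_class t (r * s))) =>
    //.
  by apply: closure_coset => // q _; exact: coprimep_dvdl.
have hwx : Q ^+ n %| golomb_val (h w) - golomb_val (h x).
  apply: (clw x a b); rewrite -?mE //.
  by apply: dvdp_trans bdw; rewrite dvdp_mulr.
have hwz : Q ^+ n %| golomb_val (h w) - golomb_val (h z).
  apply: (clw z c d); rewrite -?lE //.
  by apply: dvdp_trans bdw; rewrite dvdp_mull.
have -> : golomb_val (h z) - golomb_val (h x) =
    golomb_val (h w) - golomb_val (h x) - (golomb_val (h w) - golomb_val (h z)).
  by rewrite opprB [RHS]addrC addrA subrK.
exact: dvdp_sub.
Qed.

(** * Torsion over algebraic extensions of F_p *)

Lemma pigeonhole_nat (T : finType) (f : nat -> T) : exists i j, (i < j)%N /\ f i = f j.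
Proof.
pose F (i : 'I_(#|T|.+1)) := f i.
have /injectivePn[i [j ij Fij]] : ~~ injectiveb F.
  apply/negP => /injectiveP /leq_card; by rewrite card_ord ltnn.
have [lt_ij|lt_ji|/val_inj/eqP] := ltngtP i j; last by rewrite (negbTE ij).
  by exists i, j.
by exists j, i.
Qed.

Lemma exists_iter_Frobenius (p : nat) (R : comNzRingType) (pR : p \in [pchar R]) n :
  exists phi : {rmorphism R -> R}, forall a, phi a = a ^+ (p ^ n).
Proof.
elim: n => [|n [phi phiE]]; first by exists idfun => a; rewrite expn0 expr1.
by exists (pFrobenius_aut pR \o phi) => a; rewrite /= phiE pFrobenius_autE -exprM
  expnSr.
Qed.

Section FrobeniusPeriodic.
Variables (p : nat) (K : fieldType) (pK : p \in [pchar K]).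
Implicit Types (a c : K) (M f : {poly K}).

(** In characteristic [p], this says that [a] lies in a finite subfield. *)
Definition frobenius_periodic a : Prop := exists2 n, (0 < n)%N & a ^+ (p ^ n) = a.

Lemma frobenius_periodicI a i j : (i < j)%N -> a ^+ (p ^ i) = a ^+ (p ^ j) ->
  frobenius_periodic a.
Proof.
move=> ij aij; exists (j - i)%N; rewrite ?subn_gt0 //.
have [phi phiE] := exists_iter_Frobenius pK i.
apply: (fmorph_inj phi); rewrite !phiE -exprM -expnD subnK //; exact: ltnW.
Qed.

Lemma frobenius_periodicX a n k : a ^+ (p ^ n) = a -> a ^+ (p ^ (n * k)) = a.
Proof.
by move=> an; elim: k => [|k IH]; rewrite ?muln0 ?expn0 // mulnS expnD exprM an.
Qed.

(** Every power of [a] is the value at [a] of a remainder modulo [q], and over a finite field there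
    are finitely many remainders. *)
Lemma algebraic_periodic (F : finFieldType) (iota : {rmorphism F -> K}) a :
  algebraicOver iota a -> frobenius_periodic a.
Proof.
move=> [q q0 qa].
have aE n : a ^+ n = (map_poly iota ('X^n %% q)).[a].
  have : (map_poly iota 'X^n).[a] = a ^+ n by rewrite map_polyXn hornerXn.
  rewrite {1}(divp_eq 'X^n q) rmorphD rmorphM hornerD hornerM (eqP qa) mulr0 add0r.
  by move=> ->.
have sq n : (size ('X^n %% q)%R <= size q)%N by rewrite ltnW // ltn_modp.
have [i [j [ij /(congr1 rVpoly) E]]] :=
  pigeonhole_nat (fun k => poly_rV ('X^(p ^ k) %% q) : 'rV[F]_(size q)).
apply: (frobenius_periodicI ij); rewrite !aE.
by move: E; rewrite !poly_rV_K ?sq // => ->.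
Qed.

Lemma unity_periodic c N : (0 < N)%N -> c ^+ N = 1 -> frobenius_periodic c.
Proof.
case: N => // N _ cN.
have [i [j [ij E]]] := pigeonhole_nat (fun k => inord (p ^ k %% N.+1) : 'I_N.+1).
have {E} E : p ^ i = p ^ j %[mod N.+1].
  by move/(congr1 val): E; rewrite /= !inordK ?ltn_pmod.
by apply: (frobenius_periodicI ij); rewrite -(expr_mod _ cN) E expr_mod.
Qed.

Lemma common_period (s : seq K) : (forall a, a \in s -> frobenius_periodic a) ->
  exists2 n, (0 < n)%N & forall a, a \in s -> a ^+ (p ^ n) = a.
Proof.
elim: s => [|a s IH] sP; first by exists 1%N.
have [|n n0 ns] := IH; first by move=> b bs; apply: sP; rewrite in_cons bs orbT.
have [m m0 ma] := sP a (mem_head a s).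
exists (m * n)%N; first by rewrite muln_gt0 m0.
move=> b /predU1P[->|/ns bn]; first exact: frobenius_periodicX.
by rewrite mulnC; exact: frobenius_periodicX.
Qed.

Lemma exists_roots_seq (P : {poly K}) : P != 0 ->
  exists2 s : seq K, uniq s & forall a, (a \in s) = root P a.
Proof.
move=> P0; pose good n := `[< exists s : seq K, [/\ uniq s,
  all (root P) s & size s = n] >].
have ex : exists n, good n by exists 0%N; apply/asboolP; exists [::].
have ub n : good n -> (n <= size P)%N.
  by move=> /asboolP[s [us rs <-]]; apply/ltnW/max_poly_roots.
have [n /asboolP[s [us rs sn]] maxn] := ex_maxnP ex ub.
exists s => // a; apply/idP/idP => [|ra]; first exact: (allP rs).
apply: contrapT => /negP nas; suff /maxn : good n.+1 by rewrite ltnn.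
by apply/asboolP; exists (a :: s); rewrite /= nas us ra rs sn.
Qed.

Definition fixed_poly n : {poly K} := 'X^(p ^ n) - 'X.

Lemma fixed_polyP n a : reflect (a ^+ (p ^ n) = a) (root (fixed_poly n) a).
Proof. by rewrite rootE !hornerE subr_eq0; exact: eqP. Qed.

Lemma fixed_poly_neq0 n : (0 < n)%N -> fixed_poly n != 0.
Proof.
move=> n0; have p1 : (1 < p ^ n)%N.
  by rewrite -(expn0 p) ltn_exp2l // prime_gt1 // (pcharf_prime pK).
rewrite -size_poly_gt0 size_polyDl ?size_polyXn // size_polyN size_polyX.
exact: leq_trans p1 _.
Qed.

(** All coefficients lie in one finite subfield, fixed by an iterate of Frobenius, and so do those
    of the remainders of [f ^+ k] modulo [M]. Two remainders agree, and the smaller power of [f],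
    being coprime to [M], cancels. *)
Lemma poly_torsion M f : (forall a, frobenius_periodic a) -> M != 0 -> coprimep M f ->
  exists2 N, (0 < N)%N & M %| f ^+ N - 1.
Proof.
move=> per M0 Mf.
have [n n0 fixn] := @common_period (M ++ f) (fun a _ => per a).
have [phi phiE] := exists_iter_Frobenius pK n.
have fixP (g : {poly K}) : (forall i, g`_i ^+ (p ^ n) = g`_i) -> map_poly phi g = g.
  by move=> gi; apply/polyP => i; rewrite coef_map /= phiE.
have fix0 : (0 : K) ^+ (p ^ n) = 0 by rewrite -phiE rmorph0.
have phiM : map_poly phi M = M.
  apply: fixP => i; have [iM|iM] := ltnP i (size M); last by rewrite nth_default.
  by apply: fixn; rewrite mem_cat mem_nth.
have phif : map_poly phi f = f.
  apply: fixP => i; have [iM|iM] := ltnP i (size f); last by rewrite nth_default.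
  by apply: fixn; rewrite mem_cat mem_nth ?orbT.
have [s us sP] := exists_roots_seq (fixed_poly_neq0 n0).
have fs k i : (f ^+ k %% M)`_i \in s.
  rewrite sP; apply/fixed_polyP; rewrite -phiE -coef_map /=.
  by rewrite map_modp rmorphXn /= phif phiM.
have [i [j [ij E]]] := pigeonhole_nat (fun k => [ffun l : 'I_(size M) =>
  inord (index (f ^+ k %% M)`_l s) : 'I_(size s).+1]).
have {}E : f ^+ i %% M = f ^+ j %% M.
  apply/polyP => l; have [lM|Ml] := ltnP l (size M); last first.
    by rewrite !nth_default // (leq_trans _ Ml) // ltnW // ltn_modp.
  have /(congr1 val) := congr1 (fun g : {ffun _ -> _} => g (Ordinal lM)) E.
  rewrite !ffunE /= !inordK ?ltnS ?index_size // => /(congr1 (nth 0 s)).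
  by rewrite !nth_index.
exists (j - i)%N; first by rewrite subn_gt0.
have : M %| f ^+ j - f ^+ i by rewrite /dvdp modpD modpN E subrr.
rewrite -{1}(subnK (ltnW ij)) exprD -{2}[f ^+ i]mul1r -mulrBl Gauss_dvdpl //.
exact: coprimep_expr.
Qed.

End FrobeniusPeriodic.

Lemma mul_closed_unity (K : fieldType) (s : seq K) : uniq s -> 0 \notin s ->
  {in s &, forall a b, a * b \in s} -> {in s, forall a, a ^+ size s = 1}.
Proof.
move=> us s0 sM a as_.
have a0 : a != 0 by apply: contraNneq s0 => <-.
have sb : {subset map ( *%R a) s <= s} by move=> _ /mapP[b bs ->]; exact: sM.
have um : uniq (map ( *%R a) s) by rewrite map_inj_uniq //; exact: mulfI.
have [_ E] := uniq_min_size um sb (eq_leq (esym (size_map _ _))).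
have P : \prod_(b <- map ( *%R a) s) b = \prod_(b <- s) b.
  by apply: perm_big; exact: uniq_perm.
have P0 : \prod_(b <- s) b != 0.
  by rewrite prodf_seq_neq0; apply/allP => b bs /=; apply: contraNneq s0 => <-.
apply: (mulIf P0); rewrite mul1r -[RHS]P big_map big_split /=.
by rewrite big_const_seq count_predT iter_mulr_1.
Qed.

Lemma mul_closed_prim_root (K : fieldType) (s : seq K) : uniq s -> 0 \notin s ->
  (0 < size s)%N -> {in s &, forall a b, a * b \in s} ->
  exists2 z, z \in s & (size s).-primitive_root z.
Proof.
move=> us s0 s1 sM; apply/hasP; apply: has_prim_root => //.
by apply/allP => a /(mul_closed_unity us s0 sM); rewrite unity_rootE => ->.
Qed.

(** * Radical classes and linked elements *)

Section SameRadical.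
Variable K : fieldType.
Implicit Types (f g q y z P Q : {poly K}) (v w : K).

(** Equality of the sets of prime divisors, phrased through coprimality alone so that homeomorphisms
    transport it. *)
Definition same_radical f y : Prop :=
  y != 0 /\ forall q, q != 0 -> coprimep q y = coprimep q f.

(** For nonzero [f], this characterizes the positive powers of a prime, up to units, by
    coprimality. *)
Definition primary f : Prop :=
  ~~ coprimep f f /\ forall y z, y != 0 -> z != 0 ->
    ~~ coprimep f y -> ~~ coprimep f z -> ~~ coprimep y z.

Lemma same_radical_refl f : f != 0 -> same_radical f f.
Proof. by []. Qed.

Lemma same_radicalM f y z : same_radical f y -> same_radical f z ->
  same_radical f (y * z).
Proof.
move=> [y0 fy] [z0 fz]; split=> [|q q0]; first exact: mulf_neq0.
by rewrite coprimepMr fy // fz // andbb.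
Qed.

Lemma same_radicalX f y n : same_radical f y -> same_radical f (y ^+ n.+1).
Proof.
move=> fy; elim: n => [|n IH]; first by rewrite expr1.
by rewrite exprS; exact: same_radicalM.
Qed.

Lemma same_radicalZ f y v : v != 0 -> same_radical f y -> same_radical f (v *: y).
Proof.
move=> v0 [y0 fy]; split=> [|q q0]; first by rewrite scaler_eq0 negb_or v0.
by rewrite coprimepZr // fy.
Qed.

(** Factors [g] are removed until [g] no longer divides [y]; the hypothesis then makes [y] coprime
    to itself, hence constant. *)
Lemma irreducible_radical g y : irreducible_poly g -> y != 0 ->
  (forall q, q != 0 -> coprimep q g -> coprimep q y) ->
  exists v n, v != 0 /\ y = v *: g ^+ n.
Proof.
move=> irr; have [N] := ubnP (size y); elim: N y => // N IH y yN y0 H.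
have g0 := irredp_neq0 irr; have [g1 _] := irr.
have [/dvdpP[y' yE]|gy] := boolP (g %| y); last first.
  have : coprimep y y by apply: H; rewrite // coprimep_sym irreducible_coprimep.
  rewrite coprimepp => /size_poly1P[v v0 ->].
  by exists v, 0%N; rewrite expr0 alg_polyC.
have y'0 : y' != 0 by apply: contraNneq y0 => y'0; rewrite yE y'0 mul0r.
have [|//|q q0 qg|v [n [v0 y'E]]] := IH y'.
- move: yN; rewrite yE size_mul // -[size g]prednK ?(ltnW g1) // addnS /= ltnS.
  apply: leq_trans; rewrite -[X in (X < _)%N]addn0 ltn_add2l -ltnS prednK ?(ltnW g1) //.
- have := H q q0 qg; rewrite yE coprimepMr; by case/andP.
by exists v, n.+1; rewrite yE y'E exprSr scalerAl.
Qed.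

Lemma irreducible_same_radical g y : irreducible_poly g -> same_radical g y ->
  exists v n, v != 0 /\ y = v *: g ^+ n.+1.
Proof.
move=> irr [y0 gy]; have [g1 _] := irr; have g0 := irredp_neq0 irr.
have [|v [[|n] [v0 yE]]] := irreducible_radical irr y0 _; first by move=> q /gy ->.
  move: (gy g g0); rewrite yE expr0 coprimepZr // coprimep1 coprimepp.
  by rewrite gtn_eqF.
by exists v, n.
Qed.

Lemma irreducible_primary g : irreducible_poly g -> primary g.
Proof.
move=> irr; have [g1 _] := irr; split; first by rewrite coprimepp gtn_eqF.
move=> y z y0 z0 gy gz; have {}gy : g %| y by apply: contraNT gy;
  exact: irreducible_coprimep.
have {}gz : g %| z by apply: contraNT gz; exact: irreducible_coprimep.
apply/negP => /(coprimep_dvdr gy)/(coprimep_dvdl gz).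
by rewrite coprimepp gtn_eqF.
Qed.

Lemma primary_irreducible f : f != 0 -> primary f ->
  exists2 g, irreducible_poly g & forall q, q != 0 -> coprimep q f = coprimep q g.
Proof.
move=> f0 [ff fP]; have f1 : (1 < size f)%N.
  by rewrite ltn_neqAle size_poly_gt0 f0 eq_sym -coprimepp ff.
have [g irr gf] := exists_irreducible f1; have [g1 _] := irr.
have g0 := irredp_neq0 irr.
exists g => // q q0; apply/idP/idP; first exact: coprimep_dvdl.
apply: contraLR => qf; apply: (fP _ _ q0 g0); first by rewrite coprimep_sym.
apply/negP => /(coprimep_dvdr gf); by rewrite coprimepp gtn_eqF.
Qed.

(* [y] is linked to [f] when the [Q]-adic neighbourhoods of [f] and the [P]-adic
   neighbourhoods of [y] always meet inside the radical class of [f]. *)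
Definition linked f P Q y : Prop := same_radical f y /\
  forall m : nat, exists z, [/\ same_radical f z, Q ^+ m %| z - f & P ^+ m %| z - y].

End SameRadical.

(** * Transport of radicals and links by a homeomorphism *)

Section HomeoLinked.
Variables (K K' : fieldType) (h : golomb {poly K} -> golomb {poly K'})
  (g : golomb {poly K'} -> golomb {poly K}).
Hypothesis hg : inverse_homeos h g.
Implicit Types (f y P Q : golomb {poly K}).

Lemma homeo_same_radical f y : same_radical (golomb_val f) (golomb_val y) ->
  same_radical (golomb_val (h f)) (golomb_val (h y)).
Proof.
have [hK gK _ _] := hg; move=> [_ fy]; split=> [|q q0]; first exact: golomb_neq0.
have -> : q = golomb_val (h (g (Golomb q0))) by rewrite gK.
by rewrite !(homeo_coprimep _ _ hg) fy // golomb_neq0.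
Qed.

Lemma homeo_primary f : primary (golomb_val f) -> primary (golomb_val (h f)).
Proof.
have [hK gK _ _] := hg; move=> [ff fP]; split; first by rewrite (homeo_coprimep _ _ hg).
move=> y z y0 z0.
have -> : y = golomb_val (h (g (Golomb y0))) by rewrite gK.
have -> : z = golomb_val (h (g (Golomb z0))) by rewrite gK.
by rewrite !(homeo_coprimep _ _ hg); apply: fP; exact: golomb_neq0.
Qed.

(** Adic continuity is used at [y] for [P] and at [f] for [Q]; [y] is coprime to [P] because it has
    the prime divisors of [f]. *)
Lemma homeo_linked f P Q y :
  coprimep (golomb_val f) (golomb_val P) -> coprimep (golomb_val f) (golomb_val Q) ->
  linked (golomb_val f) (golomb_val P) (golomb_val Q) (golomb_val y) ->
  linked (golomb_val (h f)) (golomb_val (h P)) (golomb_val (h Q)) (golomb_val (h y)).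
Proof.
move=> fP fQ [fy fl]; split; first exact: homeo_same_radical.
move=> m.
have yP : coprimep (golomb_val y) (golomb_val P).
  by have [_ fy'] := fy; rewrite coprimep_sym fy' ?golomb_neq0 // coprimep_sym.
have [d Pd] := homeo_adic_continuous m hg yP.
have [e Qe] := homeo_adic_continuous m hg fQ.
have [z [[z0 fz] Qz Pz]] := fl (d + e)%N.
exists (golomb_val (h (Golomb z0))); split; first exact: homeo_same_radical.
  by apply: Qe; apply: dvdp_trans Qz; rewrite dvdp_exp2l // leq_addl.
by apply: Pd; apply: dvdp_trans Pz; rewrite dvdp_exp2l // leq_addr.
Qed.

End HomeoLinked.

(* Over [K], torsion makes [f] an adic limit of other elements of its radical
   class; over [K'], [w *: 'X^n] congruent to ['X] modulo ['X - 1] and ['X - t]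
   forces [w = 1] and [t ^+ n = t]. *)
Lemma homeo_finite_order (p : nat) (K K' : fieldType) (pK : p \in [pchar K])
    (h : golomb {poly K} -> golomb {poly K'}) g : inverse_homeos h g ->
  (forall a : K, frobenius_periodic p a) ->
  forall t : K', t != 0 -> exists2 N, (0 < N)%N & t ^+ N = 1.
Proof.
move=> hg per t t0; have [hK gK _ _] := hg; have gh := inverse_homeosC hg.
have irrX : irreducible_poly ('X : {poly K'}) by rewrite -[X in irreducible_poly
  X]subr0 -polyC0; exact: irredp_XsubC.
pose X' : golomb {poly K'} := Golomb (irredp_neq0 irrX).
pose L (a : K') : golomb {poly K'} := Golomb (irredp_neq0 (irredp_XsubC a)).
pose f := g X'.
have cL (a : K') : a != 0 -> coprimep (golomb_val f) (golomb_val (g (L a))).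
  by move=> a0; rewrite (homeo_coprimep _ _ gh) /= coprimep_XsubC rootX.
have [d Pd] := homeo_adic_continuous 1 hg (cL t t0).
have [e Qe] := homeo_adic_continuous 1 hg (cL 1 (oner_neq0 _)).
set P := golomb_val (g (L t)) in Pd; set Q := golomb_val (g (L 1)) in Qe.
have f0 : golomb_val f != 0 := golomb_neq0 f.
have PQ0 : P ^+ d * Q ^+ e != 0 by rewrite mulf_neq0 // expf_neq0 // golomb_neq0.
have [|N N0 PQN] := poly_torsion pK per PQ0 (f := golomb_val f).
  by rewrite coprimepMl !coprimep_expl // coprimep_sym cL // oner_neq0.
pose z := Golomb (expf_neq0 N.+1 f0).
have zf : P ^+ d * Q ^+ e %| golomb_val z - golomb_val f.
  by rewrite /= exprSr -{3}[golomb_val f]mul1r -mulrBl dvdp_mulr.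
have := Pd z (dvdp_trans (dvdp_mulr _ (dvdpp _)) zf).
have := Qe z (dvdp_trans (dvdp_mull _ (dvdpp _)) zf).
rewrite !gK !expr1.
have /(irreducible_same_radical irrX)[w [n [w0 hzE]]] : same_radical 'X (golomb_val
  (h z)).
  have -> : 'X = golomb_val (h f) by rewrite gK.
  by apply: (homeo_same_radical hg); apply: same_radicalX; exact: same_radical_refl.
rewrite hzE /= !dvdp_XsubCl !rootE !hornerE expr1n mulr1 subr_eq0.
move=> /eqP w1; rewrite w1 mul1r subr_eq0 exprS => /eqP tn.
have {}tn : t ^+ n = 1 by apply: (mulfI t0); rewrite tn mulr1.
case: n => [|n] in hzE tn *; last by exists n.+1.
(* The case [n = 0] would give [z = f], making [f] a unit although [h] sends it to ['X]. *)
have /(can_inj hK)/(congr1 (@golomb_val _))/= zE : h z = h f.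
  by apply: golomb_val_inj; rewrite hzE w1 scale1r gK expr1.
have ff : coprimep (golomb_val f) (golomb_val f).
  have : coprimep (golomb_val f) (golomb_val f ^+ N).
    rewrite coprimep_sym; apply/Bezout_eq1_coprimepP.
    have : golomb_val f ^+ N = 1 by apply: (mulfI f0); rewrite -exprS zE mulr1.
    by move=> ->; exists (1, 0); rewrite mul0r addr0 mulr1.
  by rewrite coprimep_pexpr.
have := homeo_coprimep f f hg; rewrite ff gK /= coprimepp size_polyX.
by [].
Qed.

(** * Elements linked to ['X] *)

Section LinkedX.
Variables (p : nat) (K : fieldType) (pK : p \in [pchar K]).
Implicit Types (a c u v w : K) (y : {poly K}).

Let p0 k : (0 < p ^ k)%N.
Proof. by rewrite expn_gt0 prime_gt0 // (pcharf_prime pK). Qed.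

Lemma poly_exp_pcharB (f g : {poly K}) k :
  (f - g) ^+ (p ^ k) = f ^+ (p ^ k) - g ^+ (p ^ k).
Proof.
have pP : p \in [pchar {poly K}] by rewrite pchar_poly.
have [phi phiE] := exists_iter_Frobenius pP k.
by rewrite -!phiE rmorphB.
Qed.

(** In characteristic [p], the divisor is ['X^(p ^ k)] minus a constant, so modulo it [p ^ k]-th
    powers of ['X] are constants. The difference reduces to [b *: 'X^r - v%:P] with [r < p ^ k], of
    too small a degree to be a nonzero multiple. *)
Lemma XsubC_exp_dvdp a k u v i j : a != 0 -> u != 0 -> v != 0 ->
  ('X - a%:P) ^+ (p ^ k) %| u *: 'X^i - v *: 'X^j -> i = j %[mod p ^ k].
Proof.
wlog ji : i j u v / (j <= i)%N.
  move=> H a0 u0 v0 D; have [ji|/ltnW ij] := leqP j i; first exact: H D.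
  by apply/esym; apply: (H _ _ v u) => //; rewrite -dvdpNr opprB.
move=> a0 u0 v0; rewrite -(subnK ji); set d := (i - j)%N.
rewrite exprD scalerAl -[X in _ - v *: X]mul1r scalerAl -mulrBl Gauss_dvdpl; last first.
  by rewrite coprimep_expl // coprimep_expr // coprimep_sym coprimep_XsubC rootX.
rewrite {1}(divn_eq d (p ^ k)) exprD => D.
set b := u * a ^+ (d %/ p ^ k * p ^ k).
have b0 : b != 0 by rewrite mulf_neq0 // expf_neq0.
have {D} : ('X - a%:P) ^+ (p ^ k) %| b *: 'X^(d %% p ^ k) - v%:P.
  have E : ('X - a%:P) ^+ (p ^ k) %|
      u *: (('X^(d %/ p ^ k * p ^ k) - (a ^+ (d %/ p ^ k * p ^ k))%:P) * 'X^(d %% p ^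
        k)).
    rewrite dvdpZr // dvdp_mulr // polyC_exp !exprM -poly_exp_pcharB.
    by apply: dvdp_exp2r; rewrite dvdp_XsubCl rootE !hornerE subrr.
  have -> : b *: 'X^(d %% p ^ k) - v%:P = u *: ('X^(d %/ p ^ k * p ^ k) * 'X^(d %% p
    ^ k)) - v *: 1
      - u *: (('X^(d %/ p ^ k * p ^ k) - (a ^+ (d %/ p ^ k * p ^ k))%:P) * 'X^(d %% p
        ^ k)).
    rewrite mulrBl scalerBr opprB [RHS]addrC [RHS]addrA -alg_polyC; congr (_ - _).
    by rewrite subrK mul_polyC scalerA.
  by rewrite dvdp_sub.
set r := (d %% p ^ k)%N; have rk : (r < p ^ k)%N by rewrite ltn_mod.
move=> D; suff r0 : r = 0%N by rewrite -modnDml -/r r0.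
have R0 : b *: 'X^r - v%:P = 0.
  apply/eqP; apply: contraTT D => R0; apply/negP => /(dvdp_leq R0).
  rewrite size_exp_XsubC leqNgt ltnS => /negP; apply.
  rewrite (leq_trans (size_polyD _ _)) // geq_max size_polyN size_polyC v0.
  by rewrite size_scale // size_polyXn rk p0.
have /eqP := congr1 (fun f : {poly K} => f`_0) R0.
have [->//|r1] := posnP r.
rewrite coefB coefZ coefXn coefC coef0 (ltn_eqF r1) /=.
by rewrite mulr0 sub0r oppr_eq0 (negbTE v0).
Qed.

Lemma irredp_X : irreducible_poly ('X : {poly K}).
Proof. by rewrite -[X in irreducible_poly X]subr0 -polyC0; exact: irredp_XsubC. Qed.

Lemma linked_X c s y : frobenius_periodic p c -> s.-primitive_root c ->
  linked 'X ('X - c%:P) ('X - 1%:P) y <->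
  exists2 i, (i < s)%N & y = c ^+ i *: 'X.
Proof.
move=> [n0 n0_gt0 cn0] prim.
have c0 : c != 0.
  apply/eqP => c0; have := prim_expr_order prim; rewrite c0 expr0n.
  by rewrite gtn_eqF ?(prim_order_gt0 prim) // => /eqP; rewrite eq_sym oner_eq0.
split=> [[yX yl]|[i i_s ->]].
  have [v [r [v0 yE]]] := irreducible_same_radical irredp_X yX.
  have zP k : exists n, [/\ n = 0 %[mod p ^ k],
    r = 0 %[mod p ^ k] & v * c ^+ r.+1 = c ^+ n.+1].
    have [z [zX z1 zc]] := yl (p ^ k)%N.
    have [w [n [w0 zE]]] := irreducible_same_radical irredp_X zX.
    have pk1 : (p ^ k)%N = (p ^ k).-1.+1 by rewrite prednK.
    have [w1 n1] : w = 1 /\ n = 0 %[mod p ^ k].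
      split.
        have : 'X - 1%:P %| z - 'X by apply: dvdp_trans z1; rewrite pk1 exprS dvdp_mulr.
        by rewrite zE dvdp_XsubCl rootE !hornerE expr1n mulr1 subr_eq0 => /eqP.
      apply/eqP; rewrite -(eqn_modDr 1) addn1 add0n; apply/eqP.
      apply: (XsubC_exp_dvdp (a := 1) _ w0 (oner_neq0 _)); first exact: oner_neq0.
      by rewrite scale1r expr1 -zE.
    exists n; split=> //.
      rewrite -n1; apply/esym/eqP; rewrite -(eqn_modDr 1) !addn1; apply/eqP.
      by apply: (XsubC_exp_dvdp c0 w0 v0); rewrite -zE -yE.
    have : 'X - c%:P %| z - y by apply: dvdp_trans zc; rewrite pk1 exprS dvdp_mulr.
    by rewrite zE yE w1 dvdp_XsubCl rootE !hornerE subr_eq0 => /eqP->.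
  have r0 : r = 0%N.
    have [n [_ + _]] := zP r; rewrite !modn_small //;
      last by rewrite ltn_expl // prime_gt1 // (pcharf_prime pK).
  have [n [_ _]] := zP 0%N; rewrite r0 expr1 exprSr => /(mulIf c0) vE.
  exists (n %% s)%N; first by rewrite ltn_mod (prim_order_gt0 prim).
  by rewrite (prim_expr_mod prim) yE r0 vE expr1.
split; first by apply: same_radicalZ; [exact: expf_neq0|apply: same_radical_refl;
  rewrite polyX_eq0].
(* A multiple of the period [n0] gives [c ^+ (p ^ k) = c], and the factor [m] makes [p ^ k] at least
   [m]. *)
move=> m; pose k := (n0 * m)%N.
have mk : (m <= p ^ k)%N.
  apply: ltnW; apply: (@leq_trans (p ^ m)); first by rewrite ltn_expl // prime_gt1 //
    (pcharf_prime pK).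
  by rewrite leq_exp2l ?prime_gt1 ?(pcharf_prime pK) // /k leq_pmull.
have ck : c ^+ (p ^ k) = c by exact: frobenius_periodicX.
have pX a : 'X - a%:P %| 'X^i - (a ^+ i)%:P by rewrite dvdp_XsubCl rootE !hornerE subrr.
exists ('X^((i * p ^ k).+1)); split.
- by apply: same_radicalX; apply: same_radical_refl; rewrite polyX_eq0.
- have -> : 'X^((i * p ^ k).+1) - 'X = (('X^i - 1%:P) ^+ (p ^ k)) * 'X :> {poly K}.
    by rewrite poly_exp_pcharB expr1n -exprM mulrBl mul1r -exprSr.
  rewrite dvdp_mulr //; apply: dvdp_trans (dvdp_exp2l _ mk) _; apply: dvdp_exp2r.
  by have := pX 1; rewrite expr1n.
- have -> : 'X^((i * p ^ k).+1) - c ^+ i *: 'X =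
      (('X^i - (c ^+ i)%:P) ^+ (p ^ k)) * 'X :> {poly K}.
    have ci : (c ^+ i) ^+ (p ^ k) = c ^+ i by rewrite -exprM mulnC exprM ck.
    by rewrite poly_exp_pcharB -polyC_exp ci -exprM mulrBl mul_polyC -exprSr.
  by rewrite dvdp_mulr //; apply: dvdp_trans (dvdp_exp2l _ mk) _; apply: dvdp_exp2r.
Qed.

End LinkedX.

(* The quotients [y / f], for [y] linked to [f], form a group; when it is finite,
   it consists of constants because the degree is additive. *)
Section LinkedGroup.
Variables (p : nat) (K : fieldType) (pK : p \in [pchar K]).
Hypothesis per : forall a : K, frobenius_periodic p a.
Variables (f P Q : {poly K}).
Hypotheses (f0 : f != 0) (P0 : P != 0) (Q0 : Q != 0).
Hypotheses (fP : coprimep f P) (fQ : coprimep f Q).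
Implicit Types (y z : {poly K}) (v : K).

Let torsion m y : same_radical f y -> exists2 N,
  P ^+ m %| y ^+ N.+1 - 1 & Q ^+ m %| y ^+ N.+1 - 1.
Proof.
move=> [y0 fy].
have PQ0 : P ^+ m * Q ^+ m != 0 by rewrite mulf_neq0 // expf_neq0.
have PQy : coprimep (P ^+ m * Q ^+ m) y.
  by rewrite coprimepMl !coprimep_expl // fy // coprimep_sym.
have [[|N] // _ D] := poly_torsion pK per PQ0 PQy.
by exists N; apply: dvdp_trans D; [exact: dvdp_mulr|exact: dvdp_mull].
Qed.

Let cong_mul (d x x' y y' : {poly K}) : d %| x - x' -> d %| y - y' ->
  d %| x * y - x' * y'.
Proof.
move=> dx dy; have -> : x * y - x' * y' = (x - x') * y + x' * (y - y').
  by rewrite mulrBl mulrBr addrA subrK.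
by rewrite dvdp_add //; [exact: dvdp_mulr|exact: dvdp_mull].
Qed.

Let expN_mul (d y : {poly K}) N : d %| y ^+ N.+1 - 1 ->
  forall x, d %| x * y ^+ N.+1 - x.
Proof. by move=> dy x; rewrite -[X in _ - X]mulr1 -mulrBr dvdp_mull. Qed.

Lemma linked_refl : linked f P Q f.
Proof.
by split; [exact: same_radical_refl|move=> m; exists f; rewrite subrr !dvdp0; split].
Qed.

(** The natural approximation [z1 * z2 / f] is made a polynomial by replacing the inverse of [f]
    with [f ^+ N], where [f ^+ N.+1] is congruent to 1 modulo [P ^+ m] and [Q ^+ m]. *)
Lemma linked_mul y1 y2 y3 : linked f P Q y1 -> linked f P Q y2 ->
  same_radical f y3 -> f * y3 = y1 * y2 -> linked f P Q y3.
Proof.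
move=> [fy1 l1] [fy2 l2] fy3 E; split=> // m.
have [z1 [fz1 Qz1 Pz1]] := l1 m; have [z2 [fz2 Qz2 Pz2]] := l2 m.
have [N PN QN] := torsion m (same_radical_refl f0).
have cz (R x : {poly K}) : coprimep f R -> R ^+ m %| f ^+ N.+1 - 1 ->
    R ^+ m %| z1 * z2 - f * x -> R ^+ m %| z1 * z2 * f ^+ N - x.
  move=> fR RN D; rewrite -(@Gauss_dvdpr _ _ f _); last first.
    by rewrite coprimep_expl // coprimep_sym.
  have -> : f * (z1 * z2 * f ^+ N - x) = z1 * z2 * f ^+ N.+1 - z1 * z2 + (z1 * z2 - f
    * x).
    by rewrite addrA subrK mulrBr mulrCA -exprS.
  by rewrite dvdp_add // expN_mul.
exists (z1 * z2 * f ^+ N); split.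
- case: (N) => [|n]; first by rewrite mulr1; exact: same_radicalM.
  by apply: same_radicalM; [exact: same_radicalM|exact: same_radicalX].
- by apply: cz => //; exact: cong_mul.
- by apply: cz => //; rewrite E; exact: cong_mul.
Qed.

(** The approximation is [f * f / z], with [z ^+ N] in place of the inverse of [z]. *)
Lemma linked_inv y y' : linked f P Q y -> same_radical f y' -> y * y' = f * f ->
  linked f P Q y'.
Proof.
move=> [fy ly] fy' E; split=> // m.
have [z [fz Qz Pz]] := ly m; have [N PN QN] := torsion m fz.
have cz (R x x' : {poly K}) : coprimep x R -> R ^+ m %| z ^+ N.+1 - 1 ->
    R ^+ m %| z - x -> x * x' = f * f -> R ^+ m %| f * f * z ^+ N - x'.
  move=> xR RN D xE; rewrite -(@Gauss_dvdpr _ _ x _); last first.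
    by rewrite coprimep_expl // coprimep_sym.
  have -> : x * (f * f * z ^+ N - x') =
      f * f * z ^+ N.+1 - f * f - (z - x) * (f * f * z ^+ N).
    by rewrite mulrBr xE [in RHS]mulrBl [z * _]mulrCA -exprS opprB [RHS]addrC
      [RHS]addrA subrK.
  by rewrite dvdp_sub // ?expN_mul // dvdp_mulr.
exists (f * f * z ^+ N); split.
- have ff : same_radical f (f * f) by apply: same_radicalM; exact: same_radical_refl.
  case: (N) => [|n]; first by rewrite mulr1.
  by apply: same_radicalM => //; exact: same_radicalX.
- exact: (cz Q f).
- apply: (cz P y) => //.
  by have [_ fy''] := fy; rewrite coprimep_sym fy'' // coprimep_sym.
Qed.

Variable t : seq {poly K}.
Hypothesis tP : forall y, reflect (linked f P Q y) (y \in t).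

(** Finiteness of [t] bounds the exponents of [g] in linked elements. For [y] of maximal exponent, a
    quotient [y / f] of positive degree could be squared to exceed the bound; a quotient of negative
    degree has an inverse of positive degree. Hence all quotients are constant. *)
Lemma linked_scalar : primary f -> forall y, linked f P Q y ->
  exists2 v, v != 0 & y = v *: f.
Proof.
move=> /(primary_irreducible f0)[g irr gf]; have [g1 _] := irr.
have g0 := irredp_neq0 irr.
have fg y : same_radical f y <-> same_radical g y.
  by split=> -[y0 E]; split=> // q q0; rewrite E // gf.
have fvg v n : v != 0 -> same_radical f (v *: g ^+ n.+1).
  by move=> v0; apply/fg/same_radicalZ => //; apply: same_radicalX.
have [v0 [i [v00 fE]]] := irreducible_same_radical irr (iffLR (fg f)
  (same_radical_refl f0)).
pose good n := `[< exists2 v, v != 0 & linked f P Q (v *: g ^+ n.+1) >].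
have ex : exists n, good n.
  by exists i; apply/asboolP; exists v0; rewrite // -fE; exact: linked_refl.
have bound n : good n -> (n <= \max_(y <- t) size y)%N.
  move=> /asboolP[v v_neq0 /tP yt]; apply: leq_trans (leq_bigmax_seq _ yt isT).
  rewrite size_scale // -[size _]prednK ?size_poly_gt0 ?expf_neq0 // size_exp.
  rewrite mulnS -addSn (leq_trans _ (leq_addl _ _)) // -[X in (X <= _)%N]mul1n
    leq_mul2r.
  by rewrite -ltnS prednK ?(ltnW g1) // g1 orbT.
have [r /asboolP[v v_neq0 lr] maxr] := ex_maxnP ex bound.
have ir : (i <= r)%N by apply: maxr; apply/asboolP; exists v0; rewrite // -fE;
  exact: linked_refl.
have {v v_neq0 lr} ri : r = i.
  have /maxr : good (r + (r - i))%N.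
    apply/asboolP; exists (v * v / v0); first by rewrite !mulf_neq0 // invr_eq0.
    apply: (linked_mul lr lr); first by apply: fvg; rewrite !mulf_neq0 // invr_eq0.
    rewrite fE -!scalerAl -!scalerAr !scalerA -!exprD; congr (_ *: _ ^+ _).
      by rewrite mulrC divfK.
    by rewrite !addSn !addnS addnCA subnKC.
  by rewrite -[X in (_ <= X)%N]addn0 leq_add2l leqn0 subn_eq0 => ri; apply/eqP;
    rewrite eqn_leq ri.
rewrite {}ri in maxr.
move=> y ly; have [fy _] := ly.
have [v [j [v_neq0 yE]]] := irreducible_same_radical irr (iffLR (fg y) fy).
have ji : (j <= i)%N by apply: maxr; apply/asboolP; exists v; rewrite // -yE.
have /maxr : good (i + (i - j))%N.
  apply/asboolP; exists (v0 * v0 / v); first by rewrite !mulf_neq0 // invr_eq0.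
  apply: (linked_inv ly); first by apply: fvg; rewrite !mulf_neq0 // invr_eq0.
  rewrite fE yE -!scalerAl -!scalerAr !scalerA -!exprD; congr (_ *: _ ^+ _).
    by rewrite mulrC divfK.
  by rewrite !addSn !addnS addnCA subnKC.
rewrite -[X in (_ <= X)%N]addn0 leq_add2l leqn0 subn_eq0 => ij.
have {}ij : j = i by apply/eqP; rewrite eqn_leq ji.
exists (v / v0); first by rewrite mulf_neq0 // invr_eq0.
by rewrite fE yE ij scalerA divfK.
Qed.

(** The quotients [y / f], read off leading coefficients, form a finite multiplicative group of
    constants with as many elements as [t], and such a group is cyclic. *)
Lemma linked_prim_root : uniq t -> primary f ->
  exists z : K, (size t).-primitive_root z.
Proof.
move=> ut fprim; have sc := linked_scalar fprim.
have lf0 : lead_coef f != 0 by rewrite lead_coef_eq0.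
pose c y := lead_coef y / lead_coef f.
have tE y : y \in t -> c y != 0 /\ y = c y *: f.
  by move=> /tP /sc[v v0 ->]; rewrite /c lead_coefZ mulfK.
have [|||v1 v2|z _] := @mul_closed_prim_root K (map c t).
- by rewrite map_inj_in_uniq // => y z /tE[_ yE] /tE[_ zE] cyz; rewrite yE zE cyz.
- by apply/mapP => -[y /tE[+ _] /esym E]; rewrite E eqxx.
- rewrite size_map; have : f \in t by apply/tP; exact: linked_refl.
  by case: t.
- move=> /mapP[y yt ->] /mapP[z zt ->]; have [cy yE] := tE y yt;
  have [cz zE] := tE z zt.
  have yz0 := mulf_neq0 cy cz.
  have l3 : linked f P Q ((c y * c z) *: f).
    apply: (linked_mul (elimT (tP y) yt) (elimT (tP z) zt)).
      by apply: same_radicalZ => //; exact: same_radical_refl.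
    by rewrite {2}yE {2}zE -!scalerAl -!scalerAr scalerA.
  by apply/mapP; exists ((c y * c z) *: f); [exact/tP|rewrite [c (_ *: _)]/c
    lead_coefZ mulfK].
by rewrite size_map; exists z.
Qed.

End LinkedGroup.

(** For ['X], ['X - c] and ['X - 1] the linked elements are the [s] multiples [c ^+ i *: 'X].
    Transport by [h] and [g] makes their images all the elements linked to the image of ['X], so the
    group of quotients over [K'] has order [s]. *)
Lemma homeo_prim_root (p : nat) (K K' : fieldType) (pK : p \in [pchar K])
    (pK' : p \in [pchar K']) (h : golomb {poly K} -> golomb {poly K'}) g s (c : K) :
  inverse_homeos h g ->
  (forall a : K, frobenius_periodic p a) -> (forall a : K', frobenius_periodic p a) ->
  s.-primitive_root c -> exists z : K', s.-primitive_root z.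
Proof.
move=> hg per per' prim; have [hK gK _ _] := hg; have gh := inverse_homeosC hg.
have c0 : c != 0.
  apply/eqP => c0; have := prim_expr_order prim; rewrite c0 expr0n.
  by rewrite gtn_eqF ?(prim_order_gt0 prim) // => /eqP; rewrite eq_sym oner_eq0.
pose X := Golomb (irredp_neq0 (irredp_X K)).
pose L (a : K) := Golomb (irredp_neq0 (irredp_XsubC a)).
have cL (a : K) : a != 0 -> coprimep (golomb_val X) (golomb_val (L a)).
  by move=> a0; rewrite /= coprimep_XsubC rootX.
have cLh (a : K) : a != 0 -> coprimep (golomb_val (h X)) (golomb_val (h (L a))).
  by move=> a0; rewrite (homeo_coprimep _ _ hg); exact: cL.
have cX0 i : c ^+ i *: 'X != 0 :> {poly K} by rewrite scaler_eq0 negb_or expf_neq0 //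
  polyX_eq0.
pose cX i : golomb {poly K} := Golomb (cX0 i).
pose t := [seq golomb_val (h (cX i)) | i <- iota 0 s].
have tP y : reflect (linked (golomb_val (h X)) (golomb_val (h (L c))) (golomb_val (h
  (L 1))) y) (y \in t).
  apply: (iffP mapP) => [[i i_s ->]|ly].
    apply: (homeo_linked hg); [exact: cL|exact/cL/oner_neq0|].
    apply/(linked_X pK _ (per c) prim); exists i => //.
    by move: i_s; rewrite mem_iota add0n.
  have y0 : y != 0 by case: ly => -[].
  have : linked (golomb_val (g (h X))) (golomb_val (g (h (L c)))) (golomb_val (g (h
    (L 1))))
      (golomb_val (g (Golomb y0))).
    by apply: (homeo_linked gh) => //; apply: cLh => //; exact: oner_neq0.
  rewrite !hK => /(linked_X pK _ (per c) prim)[i i_s yE].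
  exists i; first by rewrite mem_iota.
  have -> : cX i = g (Golomb y0) by apply: golomb_val_inj.
  by rewrite gK.
have ut : uniq t.
  rewrite map_inj_in_uniq ?iota_uniq // => i j; rewrite !mem_iota !add0n /= => i_s j_s.
  move=> /golomb_val_inj/(can_inj hK)/(congr1 (@golomb_val _))/=.
  move=> /(congr1 (fun q : {poly K} => q`_1)); rewrite !coefZ !coefX !mulr1 => /eqP.
  by rewrite (eq_prim_root_expr prim) !modn_small // => /eqP.
have := linked_prim_root pK' per' (golomb_neq0 _) (golomb_neq0 _) (golomb_neq0 _)
  (cLh c c0) (cLh 1 (oner_neq0 _)) tP ut (homeo_primary hg (f :=
    X) (irreducible_primary (irredp_X K))).
by rewrite size_map size_iota.
Qed.

(** * Gluing morphisms of finite subfields *)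

Lemma ultrafilter_seq (I : Type) (T : eqType) (G : set_system I) (f : I ->
  T) (s : seq T) :
  UltraFilter G -> G [set k | f k \in s] -> exists b, G [set k | f k = b].
Proof.
move=> UG; elim: s => [|b s IH] Gs.
  by have [k] := filter_ex Gs.
have [Gb|Gb] := in_ultra_setVsetC [set k | f k = b] UG; first by exists b.
apply: IH; apply: filterS (filterI Gs Gb) => k [/=].
by rewrite in_cons => /predU1P[|].
Qed.

Section LocalMorphism.
Variables (F K K' : fieldType).
Variables (iota : {rmorphism F -> K}) (iota' : {rmorphism F -> K'}).

(** The minimal polynomial [m] of [c] over [F] divides ['X^s - 1], which splits over [K'] thanks to
    [z]. So [m] has a root [d] there, and sending [c] to [d] is well defined. *)
Lemma generator_morphism s (c : K) (z : K') :
  s.-primitive_root c -> s.-primitive_root z ->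
  exists (sigma : K -> K') (d : K'),
    forall q : {poly F}, sigma (map_poly iota q).[c] = (map_poly iota' q).[d].
Proof.
move=> primc primz.
have s0 := prim_order_gt0 primc.
pose u : {poly F} := 'X^s - 1.
have u0 : u != 0 by rewrite -size_poly_gt0 size_XnsubC.
have uc : root (map_poly iota u) c.
  by rewrite rmorphB rmorph1 /= map_polyXn rootE !hornerE (prim_expr_order primc) subrr.
have ex : exists n, `[< exists m : {poly F}, [/\ m != 0,
  root (map_poly iota m) c & size m = n] >].
  by exists (size u); apply/asboolP; exists u.
have [n /asboolP[m [m0 mc <-]] minm] := ex_minnP ex.
have mdvd (q : {poly F}) : (map_poly iota q).[c] = 0 -> m %| q.
  move=> qc; rewrite /dvdp -[_ == 0]negbK; apply/negP => r0.
  suff /minm : `[< exists m' : {poly F},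
      [/\ m' != 0, root (map_poly iota m') c & size m' = size (q %% m)%R] >].
    by rewrite leqNgt ltn_modp m0.
  apply/asboolP; exists (q %% m); split=> //.
  move: qc; rewrite {1}(divp_eq q m) rmorphD rmorphM hornerD hornerM (eqP mc) mulr0
    add0r.
  by move/rootP.
have m1 : (1 < size m)%N.
  rewrite ltnNge; apply/negP => /size1_polyC mE.
  move: mc m0; rewrite mE map_polyC /= rootC fmorph_eq0 polyC_eq0 => ->.
  by [].
have mu : map_poly iota' m %| \prod_(0 <= i < s) ('X - (z ^+ i)%:P).
  rewrite (factor_Xn_sub_1 primz); have -> : 'X^s - 1 = map_poly iota' u.
    by rewrite rmorphB rmorph1 /= map_polyXn.
  by rewrite dvdp_map mdvd //; exact/rootP.
have [d md] : exists d, root (map_poly iota' m) d.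
  have [msk mE] := dvdp_prod_XsubC mu; case: (mask _ _) mE => [|i l] mE.
    move: mE m1; rewrite big_nil -size_poly_eq1 size_map_poly => /eqP ->.
    by [].
  by exists (z ^+ i); rewrite -dvdp_XsubCl (eqp_dvdr _ mE) big_cons dvdp_mulr.
(* [xget] picks a polynomial with value [a] at [c]; if there is none, the default 0 makes the image
   0. *)
exists (fun a => (map_poly iota' (xget 0 [set q | (map_poly iota q).[c] = a])).[d]), d.
move=> q; set Q := [set _ | _].
have /(xgetPex 0) : exists q', Q q' by exists q.
set q' := xget 0 Q; rewrite /Q /= => q'q.
have /dvdpP[r qr] : m %| q' - q.
  by apply: mdvd; rewrite rmorphB hornerD hornerN q'q subrr.
apply/eqP; rewrite -subr_eq0 -hornerN -hornerD -rmorphB qr rmorphM hornerM.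
by rewrite (eqP md) mulr0.
Qed.

End LocalMorphism.

(** * An isomorphism from equal orders of roots of unity *)

Section PeriodicIsomorphism.
Variables (p : nat) (F K K' : fieldType) (pK : p \in [pchar K]) (pK' : p \in [pchar
  K']).
Variables (iota : {rmorphism F -> K}) (iota' : {rmorphism F -> K'}).
Hypothesis per : forall a : K, frobenius_periodic p a.
Hypothesis per' : forall a : K', frobenius_periodic p a.
Hypothesis primKK' : forall s (c : K), s.-primitive_root c ->
  exists z : K', s.-primitive_root z.
Hypothesis primK'K : forall s (z : K'), s.-primitive_root z ->
  exists c : K, s.-primitive_root c.

Let fixed n (a : K) := a ^+ (p ^ n) = a.

Let fixedP n : [/\ fixed n 0, fixed n 1, forall a b, fixed n a -> fixed n b ->
  fixed n (a - b)
  & forall a b, fixed n a -> fixed n b -> fixed n (a * b)].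
Proof.
have [phi phiE] := exists_iter_Frobenius pK n.
rewrite /fixed -!phiE rmorph0 rmorph1; split=> // a b; rewrite -!phiE => ha hb.
  by rewrite rmorphB ha hb.
by rewrite rmorphM ha hb.
Qed.

(** The nonzero fixed elements form a cyclic group, so each is a power of one root of unity [c], and
    [K'] has a root of unity of the same order to receive it. *)
Lemma fixed_morphism n : (0 < n)%N -> exists sigma : K -> K',
  [/\ sigma 1 = 1,
      forall a b, fixed n a -> fixed n b -> sigma (a - b) = sigma a - sigma b
    & forall a b, fixed n a -> fixed n b -> sigma (a * b) = sigma a * sigma b].
Proof.
move=> n0; have [fix0 fix1 fixB fixM] := fixedP n.
have [s us sP] := exists_roots_seq (fixed_poly_neq0 pK n0).
pose t := [seq a <- s | a != 0].
have tP a : (a \in t) = (a != 0) && (a ^+ (p ^ n) == a).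
  by rewrite mem_filter sP; congr (_ && _); apply/fixed_polyP/eqP.
have ut : uniq t by rewrite filter_uniq.
have t0 : 0 \notin t by rewrite tP eqxx.
have t_gt0 : (0 < size t)%N.
  have : 1 \in t by rewrite tP oner_neq0; apply/eqP.
  by case: (t).
have tM : {in t &, forall a b, a * b \in t}.
  move=> a b; rewrite !tP => /andP[a0 /eqP fa] /andP[b0 /eqP fb].
  by rewrite mulf_neq0 //=; apply/eqP/fixM.
have [c ct primc] := mul_closed_prim_root ut t0 t_gt0 tM.
have [z primz] := primKK' primc.
have [sigma [d sigmaE]] := generator_morphism iota iota' primc primz.
have gen a : fixed n a -> exists q, a = (map_poly iota q).[c].
  move=> fa; have [->|a0] := eqVneq a 0; first by exists 0; rewrite rmorph0 horner0.
  have at_ : a \in t by rewrite tP a0; apply/eqP.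
  have [i ->] := prim_rootP primc (mul_closed_unity ut t0 tM at_).
  by exists 'X^i; rewrite map_polyXn hornerXn.
exists sigma; split.
- by have := sigmaE 1; rewrite !rmorph1 !hornerC.
- move=> a b /gen[qa ->] /gen[qb ->].
  by rewrite -hornerN -hornerD -rmorphB !sigmaE rmorphB hornerD hornerN.
- move=> a b /gen[qa ->] /gen[qb ->].
  by rewrite -hornerM -rmorphM !sigmaE rmorphM hornerM.
Qed.

(* The morphisms on the finite subfields fixed by the [n`!]-th powers of Frobenius
   need not be compatible; an ultrafilter limit makes a single morphism of them. *)
Lemma periodic_morphism : exists sigma : {rmorphism K -> K'}, True.
Proof.
have [f fP] := choice (fun n => fixed_morphism (fact_gt0 n)).
have [G [UG ooG]] := ultraFilterLemma eventually_filter.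
have fixG a : G [set n | fixed n`! a].
  apply: ooG; have [m m0 am] := per a; exists m => // n /= mn.
  have /dvdnP[k ->] : (m %| n`!)%N by apply: dvdn_fact; rewrite m0.
  by rewrite /fixed mulnC; exact: frobenius_periodicX.
have fX n a k : fixed n`! a -> fixed n`! (a ^+ k) /\ f n (a ^+ k) = f n a ^+ k.
  move=> fa; have [_ fix1 _ fixM] := fixedP n`!; have [f1 _ fM] := fP n.
  elim: k => [|k [fk fE]]; first by rewrite !expr0.
  by rewrite !exprS fM // fE; split => //; exact: fixM.
(* For a large set of indices, [f n a] is a root in [K'] of [fixed_poly p K' m], which has finitely
   many roots; the ultrafilter selects one. *)
have lim a : exists b, G [set n | f n a = b].
  have [m m0 am] := per a.
  have [s us sP] := exists_roots_seq (fixed_poly_neq0 pK' m0).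
  apply: (@ultrafilter_seq _ _ _ _ s) => //.
  apply: filterS (fixG a) => n /= fa; rewrite sP; apply/fixed_polyP.
  by have [_ <-] := fX n a (p ^ m)%N fa; rewrite am.
have [sigma sigmaP] := choice lim.
have eqG b b' (A : set nat) : G A -> A `<=` [set _ | b = b'] -> b = b' :> K'.
  by move=> GA sA; have [n] := filter_ex GA; move/sA.
have sB : zmod_morphism sigma.
  move=> a b; apply: (eqG _ _ _ (filterI (filterI (sigmaP a) (sigmaP b))
    (filterI (sigmaP (a - b)) (filterI (fixG a) (fixG b))))).
  move=> n [[/= <- <-] [<- [fa fb]]]; by have [_ -> //] := fP n.
have sM : monoid_morphism sigma.
  split=> [|a b].
    by apply: (eqG _ _ _ (sigmaP 1)) => n /= <-; have [-> //] := fP n.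
  apply: (eqG _ _ _ (filterI (filterI (sigmaP a) (sigmaP b))
    (filterI (sigmaP (a * b)) (filterI (fixG a) (fixG b))))).
  move=> n [[/= <- <-] [<- [fa fb]]]; by have [_ _ -> //] := fP n.
pose sB' := GRing.isZmodMorphism.Build K K' sigma sB.
pose sM' := GRing.isMonoidMorphism.Build K K' sigma sM.
by exists (HB.pack_for {rmorphism K -> K'} sigma sB' sM').
Qed.

(** Only surjectivity needs proof. A nonzero [y] is a root of unity, of order [s] say; [K] has a
    primitive [s]-th root [c], its image is again primitive, and [y] is a power of that image. *)
Lemma periodic_isomorphic : field_isomorphic K K'.
Proof.
have [sigma _] := periodic_morphism; exists sigma.
have surj y : exists x, sigma x = y.
  have [->|y0] := eqVneq y 0; first by exists 0; rewrite rmorph0.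
  have [n n0 yn] := per' y.
  have pn : (1 < p ^ n)%N by rewrite -(expn0 p) ltn_exp2l // prime_gt1 //
    (pcharf_prime pK).
  have y1 : y ^+ (p ^ n).-1 = 1.
    by apply: (mulfI y0); rewrite mulr1 -exprS prednK // ltnW.
  have [|s prims _] := prim_order_exists _ y1; first by rewrite -ltnS prednK // ltnW.
  have [c primc] := primK'K prims.
  have prim_sc : s.-primitive_root (sigma c) by rewrite fmorph_primitive_root.
  have [i ->] := prim_rootP prim_sc (prim_expr_order prims).
  by exists (c ^+ i); rewrite rmorphXn.
have [tau tauK] := choice surj.
by exists tau => // x; apply: (fmorph_inj sigma); rewrite tauK.
Qed.

End PeriodicIsomorphism.

Theorem theorem7p5 (p : nat) (p_prime : prime p) (K K' : fieldType)
    (pK : p \in [pchar K]%R) (pK' : p \in [pchar K']%R)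
    (K_alg : algebraic_over_Fp pK)
    (GKK' : homeomorphic (golomb {poly K}) (golomb {poly K'})) :
  field_isomorphic K K'.
Proof.
have [h [g hg]] := GKK'; have {}hg : inverse_homeos h g by [].
pose iota : {rmorphism 'F_p -> pPrimeCharType pK} := GRing.in_alg (pPrimeCharType pK).
pose iota' : {rmorphism 'F_p -> pPrimeCharType pK'} :=
  GRing.in_alg (pPrimeCharType pK').
have per (a : K) : frobenius_periodic p a.
  exact: (algebraic_periodic pK (iota := iota) (K_alg a)).
have per' (a : K') : frobenius_periodic p a.
  have [->|a0] := eqVneq a 0; first by exists 1%N;
    rewrite // expr0n expn1 gtn_eqF // prime_gt0.
  have [N N0 aN] := homeo_finite_order pK hg per a0.
  exact: (unity_periodic pK' N0 aN).
apply: (periodic_isomorphic pK pK' iota iota' per per').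
(* With both fields periodic, roots of unity transfer along the homeomorphism and along its
   inverse. *)
- by move=> s c; exact: (homeo_prim_root pK pK' hg per per').
- by move=> s c; exact: (homeo_prim_root pK' pK (inverse_homeosC hg) per' per).
Qed.
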